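(* Let $q$ be a prime power, $m,n,k$ positive integers and $\rho\in\{1,\ldots,\min\{k,m\}\}$. Let $\mathcal{U}$ be a rank-$\rho$-saturating $[n,k]_{q^m/q}$ system. Then \[\begin{bmatrix} n\\ \rho\end{bmatrix}_q\ge q^{m(k-\rho)}.\] In particular, $n\ge \lceil mk/\rho\rceil-m+\rho$ if $q>2$; $n\ge \lceil (mk-1)/\rho\rceil-m+\rho$ if $q=2$ and $\rho>1$; and $n\ge m(k-1)+1$ if $q=2$ and $\rho=1$.
   Context: $\begin{bmatrix} a\\ b\end{bmatrix}_q=\prod_{j=0}^{b-1}\frac{q^a-q^j}{q^b-q^j}$ is the Gaussian binomial coefficient. An $[n,k]_{q^m/q}$ system is an $n$-dimensional $\mathbb{F}_q$-subspace $\mathcal{U}\le\mathbb{F}_{q^m}^k$ with $\langle\mathcal{U}\rangle_{\mathbb{F}_{q^m}}=\mathbb{F}_{q^m}^k$; its linear set is $L_\mathcal{U}=\{\langle u\rangle_{\mathbb{F}_{q^m}}:u\in\mathcal{U}\setminus\{0\}\}\subseteq\mathrm{PG}(k-1,q^m)$. A point set $\mathcal{S}$ of $\mathrm{PG}(k-1,q^m)$ is $r$-saturating if every point lies in the projective subspace spanned by some $r+1$ points of $\mathcal{S}$ and $r$ is minimal with this property; $\mathcal{U}$ is rank-$\rho$-saturating if $L_\mathcal{U}$ is $(\rho-1)$-saturating. *)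

(* Defs.v *)
From HB Require Import structures.
From mathcomp Require Import all_boot all_order all_algebra all_field.
Set Implicit Arguments.
Unset Strict Implicit.
Unset Printing Implicit Defensive.
Import Order.TTheory GRing.Theory Num.Theory.
Local Open Scope ring_scope.

Definition gauss_binom (q a b : nat) : rat :=
  \prod_(j < b) ((q%:R ^+ a - q%:R ^+ j) / (q%:R ^+ b - q%:R ^+ j)).

(* Throughout, F is the field with q elements and L its extension of degree m.
   The space L^k occurs with two scalar fields: F-subspaces are taken in
   {ffun 'I_k -> L}, a vectType over F, and L-subspaces in 'rV[L]_k, a vectType
   over L; to_row identifies the two. *)
Definition to_row (F : finFieldType) (L : fieldExtType F) (k : nat)
    (u : {ffun 'I_k -> L}) : 'rV[L]_k :=
  \row_i u i.

(* <U>_L = L^k: the only L-subspace containing U is the whole space. *)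
Definition q_system (F : finFieldType) (L : fieldExtType F) (n k : nat)
    (U : {vspace {ffun 'I_k -> L}}) : Prop :=
  \dim U = n /\
  (forall W : {vspace 'rV[L]_k},
     (forall u, u \in U -> to_row u \in W) -> W = fullv).

(* PG(k-1, L), its points being the L-lines of L^k. *)
Definition pg_point (L : fieldType) (k : nat) : Type :=
  {P : {vspace 'rV[L]_k} | \dim P == 1%N}.

Definition linear_set (F : finFieldType) (L : fieldExtType F) (k : nat)
    (U : {vspace {ffun 'I_k -> L}}) (P : pg_point L k) : Prop :=
  exists u : {ffun 'I_k -> L}, [/\ u \in U, u != 0 & sval P = <[to_row u]>%VS].

Definition spanned_by_points (L : fieldType) (k : nat)
    (S : pg_point L k -> Prop) (r : nat) : Prop :=
  forall P : pg_point L k,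
    exists Q : 'I_r.+1 -> pg_point L k,
      [/\ injective Q, forall i, S (Q i)
        & (sval P <= \sum_(i < r.+1) sval (Q i))%VS].

Definition saturating (L : fieldType) (k : nat)
    (S : pg_point L k -> Prop) (r : nat) : Prop :=
  spanned_by_points S r /\
  (forall s : nat, (s < r)%N -> ~ spanned_by_points S s).

(* Meant for rho >= 1 only, because of the truncated predecessor. *)
Definition rank_saturating (F : finFieldType) (L : fieldExtType F) (k : nat)
    (U : {vspace {ffun 'I_k -> L}}) (rho : nat) : Prop :=
  saturating (linear_set U) rho.-1.

(* Main.v *)
(** Every vector of L^k lies in the L-span of r = rho vectors of U, hence in the
    L-span of some r-dimensional F-subspace of U. Each such span has at most
    q^(mr) elements, so counting bases of these subspaces instead of the subspaces
    themselves gives q^(mk) |GL_r(q)| <= (q^n - 1)...(q^n - q^(r-1)) q^(mr), which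
    is the Gaussian bound. The bounds on n follow from
    [n, r]_q < q^(r(n-r)) / prod_{i <= r} (1 - q^-i), the last product being
    larger than 1 - q^-1 - q^-2, which is at least 1/q for q > 2 and equals 1/4
    for q = 2. *)

Require Import Defs.
From HB Require Import structures.
From mathcomp Require Import all_boot all_order all_algebra all_field.
From mathcomp Require Import zify ring lra.
Import Order.TTheory GRing.Theory Num.Theory.
Local Open Scope ring_scope.

Set Implicit Arguments.
Unset Strict Implicit.

Lemma row_free_col_mx (F : fieldType) (r n : nat) (v : 'rV[F]_n)
    (M : 'M[F]_(r, n)) :
  row_free (col_mx v M) = row_free M && ~~ (v <= M)%MS.
Proof.
rewrite -!row_leq_rank -addsmxE.
have [vM | nvM] := boolP (v <= M)%MS.
  by rewrite (addsmx_idPr vM) andbF leqNgt ltnS rank_leq_row.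
rewrite andbT; apply/idP/idP => [free_vM | free_M].
  have le_sum : (\rank (v + M)%MS <= \rank v + \rank M)%N.
    exact: mxrank_adds_leqif.
  rewrite -(leq_add2l 1) (leq_trans free_vM) // (leq_trans le_sum) //.
  by rewrite leq_add2r rank_leq_row.
rewrite add1n (leq_ltn_trans free_M) //.
have : (M < v + M)%MS by rewrite /ltmx addsmxSr /= addsmx_sub submx_refl andbT.
by rewrite ltmxErank => /andP[].
Qed.

(** Matrices are built row by row: a new row must avoid the row space of the [r] free rows already
    there, and this space has [#|F| ^ r] elements. Truncated subtraction is harmless: for [r > n]
    the factor [j = n] vanishes, as does the count. *)
Lemma card_row_free (F : finFieldType) (r n : nat) :
  #|[set M : 'M[F]_(r, n) | row_free M]|
    = (\prod_(j < r) (#|F| ^ n - #|F| ^ j))%N.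
Proof.
elim: r => [|r IHr].
  rewrite big_ord0; apply/eqP/cards1P; exists 0; apply/setP=> M.
  by rewrite !inE -row_leq_rank leq0n [M]flatmx0 eqxx.
rewrite big_ord_recr /= -{}IHr -sum_nat_const -sum1dep_card.
pose stack (p : 'M[F]_(r, n) * 'rV[F]_n) : 'M[F]_(1 + r, n) := col_mx p.2 p.1.
rewrite (reindex stack) /=; last first.
  exists (fun M : 'M_(1 + r, n) => (dsubmx M, usubmx M)) => [[M v] _ | M _] /=.
    by rewrite /stack col_mxKu col_mxKd.
  exact: vsubmxK.
under eq_bigl => p do rewrite row_free_col_mx.
rewrite -(pair_big_dep (fun M => row_free M) (fun M v => ~~ (v <= M)%MS)
            (fun _ _ => 1%N)) /=.
apply: eq_big => [M|M freeM]; first by rewrite inE.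
rewrite sum1dep_card -[X in (X - _)%N](_ : #|'rV[F]_n| = _); last first.
  by rewrite card_mx mul1n.
rewrite -[X in (_ - X)%N](_ : #|[set v *m M | v : 'rV_r]| = _); last first.
  by rewrite card_imset ?card_mx ?mul1n //; apply: row_free_inj.
set Im := [set _ | _ in _]; rewrite -(cardsC Im) addKn; apply: eq_card => v.
rewrite !inE; congr (~~ _).
by apply/submxP/imsetP => [[u ->]|[u _ ->]]; exists u.
Qed.

(** The first [\rank A] rows of the invertible [row_ebase A] span the row space of [A]; its first
    [r] rows are still independent. *)
Lemma row_free_extension (F : fieldType) (r n : nat) (A : 'M[F]_(r, n)) :
  (r <= n)%N -> exists D (M : 'M[F]_(r, n)), row_free M /\ A = D *m M.
Proof.
move=> le_rn; exists (col_ebase A *m pid_mx (\rank A)).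
exists (pid_mx r *m row_ebase A); split.
  rewrite -row_leq_rank mxrankMfree ?rank_pid_mx //.
  by rewrite row_free_unit row_ebase_unit.
rewrite mulmxA -(mulmxA (col_ebase A)) mul_pid_mx.
have -> : minn r (minn (\rank A) r) = \rank A by have := rank_leq_row A; lia.
by rewrite mulmx_ebase.
Qed.

(* A vector v = w M B is also (w P^-1) (P M) B for every P in GL_r, so that
   (v, P) |-> (P M, w P^-1) is injective. *)
Lemma card_span_cover (F L : finFieldType) (f : {rmorphism F -> L})
    (r n k : nat) (B : 'M[L]_(n, k)) :
  (forall v : 'rV[L]_k, exists (M : 'M[F]_(r, n)) (w : 'rV[L]_r),
     row_free M /\ v = w *m map_mx f M *m B) ->
  (#|L| ^ k * \prod_(j < r) (#|F| ^ r - #|F| ^ j)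
     <= \prod_(j < r) (#|F| ^ n - #|F| ^ j) * #|L| ^ r)%N.
Proof.
move=> cover.
have cover1 v : exists p : 'M[F]_(r, n) * 'rV[L]_r,
    row_free p.1 && (v == p.2 *m map_mx f p.1 *m B).
  by have [M [w [freeM ->]]] := cover v; exists (M, w); rewrite freeM eqxx.
pose c v := xchoose (cover1 v).
have free_c v : row_free (c v).1 by case/andP: (xchooseP (cover1 v)).
have c_eq v : v = (c v).2 *m map_mx f (c v).1 *m B.
  by case/andP: (xchooseP (cover1 v)) => _ /eqP.
pose D := setX [set: 'rV[L]_k] [set P : 'M[F]_r | row_free P].
pose E := setX [set M : 'M[F]_(r, n) | row_free M] [set: 'rV[L]_r].
pose g (p : 'rV[L]_k * 'M[F]_r) :=
  (p.2 *m (c p.1).1, (c p.1).2 *m map_mx f (invmx p.2)).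
have inj_g : {in D &, injective g}.
  move=> [v P] [v' P']; rewrite !inE /= !row_free_unit => uP uP' [eqM eqw].
  have fK Q : Q \in unitmx -> map_mx f (invmx Q) *m map_mx f Q = 1%:M.
    by move=> uQ; rewrite -map_mxM mulVmx // map_mx1.
  have rebuild u Q : Q \in unitmx ->
      u = (c u).2 *m map_mx f (invmx Q) *m map_mx f (Q *m (c u).1) *m B.
    move=> uQ; rewrite map_mxM mulmxA -(mulmxA (c u).2) fK // mulmx1.
    exact: c_eq.
  (* [rebuild] recovers [v] from [g (v, P)] alone; then [P] is found by cancelling the row-free
     [(c v).1]. *)
  have eqv : v = v' by rewrite (rebuild v P) // eqM eqw -rebuild.
  by move: eqM; rewrite -eqv => /(row_free_inj (free_c v)) ->.
have : (#|g @: D| <= #|E|)%N.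
  apply/subset_leq_card/subsetP => x /imsetP[[v P]].
  rewrite inE /= inE [P \in _]inE => freeP ->; rewrite !inE /=.
  by rewrite andbT -row_leq_rank mxrankMfree // row_leq_rank.
rewrite card_in_imset // !cardsX !cardsT !card_row_free !card_mx.
by rewrite !mul1n.
Qed.

(** The transpose of a generator matrix of the rank-metric code attached to [U]: rows over [F] times
    this matrix give [U], rows over [L] give its [L]-span. *)
Definition basis_mx (F : finFieldType) (L : fieldExtType F) (k : nat)
    (U : {vspace {ffun 'I_k -> L}}) : 'M[L]_(\dim U, k) :=
  \matrix_i to_row (vbasis U)`_i.

Lemma to_row_coord (F : finFieldType) (L : fieldExtType F) (k : nat)
    (U : {vspace {ffun 'I_k -> L}}) (u : {ffun 'I_k -> L}) :
  u \in U ->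
  to_row u = map_mx (in_alg L) (\row_i coord (vbasis U) i u) *m basis_mx U.
Proof.
move=> Uu; apply/rowP=> j; rewrite !mxE {1}(coord_vbasis Uu) sum_ffunE.
by apply: eq_bigr => i _; rewrite !mxE ffunE mulr_algl.
Qed.

(** An [F]-basis of [U] spans [L^k] over [L]. This yields [rho <= n], needed to find [rho]
    independent vectors in [U]. *)
Lemma q_system_dim (F : finFieldType) (L : fieldExtType F) (n k : nat)
    (U : {vspace {ffun 'I_k -> L}}) :
  q_system n U -> (k <= n)%N.
Proof.
case=> <- spanU.
pose X := [seq row i (basis_mx U) | i <- enum 'I_(\dim U)].
have fullX : <<X>>%VS = fullv.
  apply: spanU => u Uu; rewrite (to_row_coord Uu) mulmx_sum_row.
  apply: memv_suml => i _; apply/memvZ/memv_span/map_f.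
  by rewrite mem_enum.
have := dim_span X; rewrite fullX size_map size_enum_ord.
by rewrite dimvf /dim /= mul1n.
Qed.

Lemma rank_saturating_cover (F : finFieldType) (L : fieldExtType F) (k r : nat)
    (U : {vspace {ffun 'I_k -> L}}) (v : 'rV[L]_k) :
  (0 < r <= \dim U)%N -> rank_saturating U r ->
  exists (M : 'M[F]_(r, \dim U)) (w : 'rV[L]_r),
    row_free M /\ v = w *m map_mx (in_alg L) M *m basis_mx U.
Proof.
case: r => // r /= le_rn [cover _].
(* Distinct points may come from vectors of [U] that are dependent over [F], so freeness is arranged
   separately. *)
suff [A [w ->]] : exists (A : 'M[F]_(r.+1, \dim U)) (w : 'rV[L]_r.+1),
    v = w *m map_mx (in_alg L) A *m basis_mx U.
  have [D [M [freeM ->]]] := row_free_extension A le_rn.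
  exists M, (w *m map_mx (in_alg L) D); split=> //.
  by rewrite map_mxM !mulmxA.
(* The zero vector gives no projective point, so saturation does not cover it. *)
have [-> | v_neq0] := eqVneq v 0.
  by exists 0, 0; rewrite !mul0mx.
have dim_v : \dim <[v]> == 1%N by rewrite dim_vline v_neq0.
have [Q [_ Q_U]] := cover (exist _ <[v]>%VS dim_v).
rewrite -memvE => /memv_sumP[x x_Q ->].
have /fin_all_exists[a x_a] i : exists a : 'rV[F]_(\dim U) * L,
    x i = a.2 *: (map_mx (in_alg L) a.1 *m basis_mx U).
  have [u [Uu _ Qi]] := Q_U i; have := x_Q i isT; rewrite Qi => /vlineP[c ->].
  by exists (\row_i coord (vbasis U) i u, c); rewrite -to_row_coord.
exists (\matrix_i (a i).1), (\row_i (a i).2).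
rewrite -mulmxA mulmx_sum_row; apply: eq_bigr => i _.
by rewrite x_a mxE row_mul -map_row rowK.
Qed.

Lemma gauss_binom_ge (F : finFieldType) (L : fieldExtType F) (k r : nat)
    (U : {vspace {ffun 'I_k -> L}}) :
  (0 < r <= k)%N -> (r <= \dim U)%N -> rank_saturating U r ->
  (#|F| ^ (\dim {:L} * (k - r)))%:R <= gauss_binom #|F| (\dim U) r.
Proof.
case/andP=> r_gt0 le_rk le_rn satU.
(* [finvect_type L] is [L] with the finiteness inherited from [F]. *)
have cover := @card_span_cover F (finvect_type L) (in_alg (finvect_type L))
  r (\dim U) k (basis_mx U).
have cardL : #|finvect_type L| = (#|F| ^ \dim {:L})%N.
  by rewrite -(card_vspacef (Vector.class (finvect_type L))) card_vspace.
have {cover} : (#|finvect_type L| ^ k * \prod_(j < r) (#|F| ^ r - #|F| ^ j)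
    <= \prod_(j < r) (#|F| ^ \dim U - #|F| ^ j) * #|finvect_type L| ^ r)%N.
  by apply: cover => v; apply: rank_saturating_cover; rewrite ?r_gt0.
have q_gt1 : (1 < #|F|)%N := finNzRing_gt1 F.
have toQ a : (r <= a)%N ->
    (\prod_(j < r) (#|F| ^ a - #|F| ^ j))%N%:R
      = \prod_(j < r) (#|F|%:R ^+ a - #|F|%:R ^+ j) :> rat.
  move=> le_ra; rewrite natr_prod; apply: eq_bigr => j _.
  by rewrite natrB ?natrX // leq_exp2l // (leq_trans (ltnW _) le_ra).
rewrite cardL -!expnM -{1}(subnK le_rk) mulnDr expnD => le_count.
rewrite /gauss_binom prodf_div -!toQ // ler_pdivlMr.
  rewrite -natrM ler_nat -(@leq_pmul2r (#|F| ^ (\dim {:L} * r))); last first.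
    by rewrite expn_gt0 ltnW.
  by rewrite mulnAC.
rewrite ltr0n; apply: prodn_gt0 => j.
by rewrite subn_gt0 ltn_exp2l.
Qed.

(* The first terms of Euler's pentagonal number expansion; the extra power makes
   the induction go through. *)
Lemma prod_one_minus_exp_ge (x : rat) (r : nat) : 0 <= x <= 1 ->
  1 - x - x ^+ 2 + x ^+ r.+1 <= \prod_(j < r) (1 - x ^+ j.+1).
Proof.
case/andP=> x_ge0 x_le1; have x2_ge0 := sqr_ge0 x.
(* The inductive step needs [y <= x ^+ 2], which fails at [y = x]; hence the induction starts from
   one factor. *)
case: r => [|r]; first by rewrite big_ord0 expr1; lra.
elim: r => [|r IHr]; first by rewrite big_ord1 expr1; lra.
rewrite big_ord_recr /=; set y := x ^+ r.+2 in IHr *.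
have y_ge0 : 0 <= y by apply: exprn_ge0.
have y_le1 : y <= 1 by apply: exprn_ile1.
have y_lex2 : y <= x ^+ 2 by apply: ler_wiXn2l.
apply: le_trans (ler_wpM2r _ IHr); last by rewrite subr_ge0.
rewrite exprS -/y -subr_ge0.
have -> : (1 - x - x ^+ 2 + y) * (1 - y) - (1 - x - x ^+ 2 + x * y)
    = y * (x ^+ 2 - y) by ring.
by rewrite mulr_ge0 ?subr_ge0.
Qed.

Lemma gauss_binom_lt (q n r c : nat) : (1 < q)%N -> (0 < r <= n)%N ->
  q%:R ^- c <= 1 - q%:R^-1 - q%:R ^- 2 :> rat ->
  gauss_binom q n r < q%:R ^+ (r * (n - r) + c).
Proof.
move=> q_gt1 /andP[r_gt0 le_rn] qc.
set Q : rat := q%:R in qc *.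
have Q_gt1 : 1 < Q by rewrite ltr1n.
have Q_gt0 : 0 < Q by apply: lt_trans Q_gt1.
have QX_gt0 i : 0 < Q ^+ i by apply: exprn_gt0.
have num_le : \prod_(j < r) (Q ^+ n - Q ^+ j) <= Q ^+ (r * n).
  rewrite mulnC exprM -[X in _ <= _ ^+ X]card_ord -prodr_const.
  apply: ler_prod => j _; rewrite subr_ge0 ler_eXn2l //.
  by rewrite (ltnW (leq_trans (ltn_ord j) le_rn)) gerDl oppr_le0 ltW.
have den_eq : \prod_(j < r) (Q ^+ r - Q ^+ j)
    = Q ^+ (r * r) * \prod_(j < r) (1 - Q^-1 ^+ j.+1).
  rewrite exprM -[X in _ ^+ X * _]card_ord -prodr_const -big_split /=.
  rewrite (reindex_inj rev_ord_inj) /=; apply: eq_bigr => j _.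
  rewrite mulrBr mulr1; congr (_ - _).
  rewrite exprVn -[X in _ = _ ^+ X / _](subnK (ltn_ord j)).
  by rewrite exprD mulfK // gt_eqF.
(* Strictness comes from the extra power in the product bound, since [qc] is an equality for
   [q = 2], [c = 2]. *)
have P_gt : Q ^- c < \prod_(j < r) (1 - Q^-1 ^+ j.+1).
  apply: lt_le_trans (prod_one_minus_exp_ge r _); last first.
    by rewrite invr_ge0 ltW //= invf_le1 // ltW.
  rewrite exprVn; apply: le_lt_trans qc _.
  by rewrite ltrDl exprVn invr_gt0.
set P := \prod_(j < r) (1 - _) in den_eq P_gt.
have P_gt0 : 0 < P by apply: lt_trans P_gt; rewrite invr_gt0.
rewrite /gauss_binom prodf_div den_eq ltr_pdivrMr ?mulr_gt0 //.
apply: le_lt_trans num_le _.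
rewrite mulrA -exprD.
have -> : (r * (n - r) + c + r * r = r * n + c)%N.
  by rewrite addnAC -mulnDr subnK.
rewrite exprD -mulrA -[ltLHS]mulr1 ltr_pM2l //.
by rewrite -ltr_pdivrMl // mulr1.
Qed.

Unset Implicit Arguments.

Theorem theorem3p3 (q m n k rho : nat)
    (F : finFieldType) (L : fieldExtType F) (U : {vspace {ffun 'I_k -> L}})
    (hq : #|F| = q) (hm : \dim {:L} = m)
    (m_gt0 : (0 < m)%N) (n_gt0 : (0 < n)%N) (k_gt0 : (0 < k)%N)
    (hrho : (1 <= rho <= minn k m)%N)
    (hU : q_system n U) (hsat : rank_saturating U rho) :
  [/\ (q ^ (m * (k - rho)))%:R <= gauss_binom q n rho,
      ((2 < q)%N ->
         Num.ceil ((m * k)%:R / rho%:R : rat) - m%:Z + rho%:Z <= n%:Z),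
      (q = 2%N -> (1 < rho)%N ->
         Num.ceil (((m * k)%:R - 1) / rho%:R : rat) - m%:Z + rho%:Z <= n%:Z)
    & (q = 2%N -> rho = 1%N -> (m * (k - 1) + 1 <= n)%N)].
Proof.
have [dimU _] := hU; have le_kn := q_system_dim hU.
case/andP: hrho; rewrite leq_min => rho_gt0 /andP[le_rk le_rm].
have le_rn := leq_trans le_rk le_kn.
have q_gt1 : (1 < q)%N by rewrite -hq finNzRing_gt1.
have binom_ge : (q ^ (m * (k - rho)))%:R <= gauss_binom q n rho.
  rewrite -hq -hm -dimU; apply: gauss_binom_ge => //; rewrite ?dimU //.
  by rewrite rho_gt0.
have rho_gt0Q : 0 < rho%:R :> rat by rewrite ltr0n.
(* Compare the exponents of [q] in the two bounds on the Gaussian binomial, then add [m * rho] to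
   both sides. *)
have exp_lt c : q%:R ^- c <= 1 - q%:R^-1 - q%:R ^- 2 :> rat ->
    (m * k < rho * (n - rho + m) + c)%N.
  move=> qc; have lt_c := gauss_binom_lt q_gt1 _ qc.
  have := le_lt_trans binom_ge (lt_c n rho _); rewrite rho_gt0 le_rn => /(_ isT).
  rewrite -natrX ltr_nat ltn_exp2l // -(ltn_add2r (m * rho)) -mulnDr subnK //.
  by rewrite mulnDr [(m * rho)%N]mulnC addnAC.
have ceil_bound (x : rat) : x <= (rho * (n - rho + m))%:R ->
    Num.ceil (x / rho%:R) - m%:Z + rho%:Z <= n%:Z.
  move=> le_x; rewrite -lerBrDr lerBlDr ceil_le_int_tmp ler_pdivrMr //.
  rewrite subzn // -PoszD -pmulrn -natrM mulnC.
  exact: le_x.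
split=> // [q_gt2 | q2 rho_gt1 | q2 rho1].
(* With [c = 1] the strict inequality is exactly [m * k <= rho * (n - rho + m)]; the condition on
   [q] becomes [q <= q^2 - q - 1]. *)
- apply: ceil_bound; have := exp_lt 1%N.
  rewrite addn1 ltnS ler_nat; apply.
  have q_ge3 : 3%:R <= q%:R :> rat by rewrite ler_nat.
  set Q : rat := q%:R in q_ge3 *.
  have Q_gt0 : 0 < Q by lra.
  rewrite -(ler_pM2r (exprn_gt0 2 Q_gt0)) expr1.
  have -> : (1 - Q^-1 - Q ^- 2) * Q ^+ 2 = Q ^+ 2 - Q - 1.
    by field; rewrite gt_eqF.
  have -> : Q^-1 * Q ^+ 2 = Q by field; rewrite gt_eqF.
  by nra.
- apply: ceil_bound; rewrite lerBlDr natr1 ler_nat.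
  by have := exp_lt 2%N; rewrite q2 addn2 ltnS; apply.
(* Here the Gaussian binomial is exactly [2^n - 1]; using [exp_lt] with [c = 2] would lose one. *)
- have := binom_ge; rewrite rho1 q2 /gauss_binom big_ord1 !expr0 expr1.
  rewrite -[2%:R - 1]/(1 : rat) divr1 -natrX => le_2n.
  have : (2 ^ (m * (k - 1)) < 2 ^ n)%N.
    rewrite -(@ltr_nat rat); lra.
  by rewrite ltn_exp2l // addn1.
Qed.
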